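(* Let $d\in\{3,4\}$ and let $f$ be an SNN polynomial of degree $d$. Then every root $\alpha\in\mathbb{C}$ of $f$ satisfies $-d\leq \mathrm{Re}(\alpha)\leq d-1$.
   Context: For an integer $k$ and a positive integer $d$, $\binom{t+k}{d}$ denotes the polynomial $\frac{(t+k)(t+k-1)\cdots(t+k-d+1)}{d!}$ in $t$. Every polynomial $f$ of degree $d$ over $\mathbb{C}$ can be written uniquely as $f(t)=\sum_{j=0}^d h_j^*\binom{t+d-j}{d}$ with $h_j^*\in\mathbb{C}$ (equivalently $\sum_{t\ge 0}f(t)x^t=\frac{\sum_{j=0}^d h_j^*x^j}{(1-x)^{d+1}}$). A non-zero polynomial $f$ of degree $d$ is called Stanley non-negative (SNN) if $(h_0^*,\ldots,h_d^* )\in(\mathbb{R}_{\ge 0})^{d+1}$. *)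

(* Defs.v *)
From HB Require Import structures.
From mathcomp Require Import all_boot all_order all_algebra.
From mathcomp Require Import reals.
From mathcomp Require Import complex.

Set Implicit Arguments.
Unset Strict Implicit.
Unset Printing Implicit Defensive.

Import Order.TTheory GRing.Theory Num.Theory.

Local Open Scope ring_scope.
Local Open Scope complex_scope.

(* The polynomial binomial(t + k, d) = (t + k)(t + k - 1)...(t + k - d + 1) / d!
   in the indeterminate t = 'X, for an integer k. *)
Definition binom_poly (R : realType) (k : int) (d : nat) : {poly R[i]} :=
  (d`!%:R)^-1 *: \prod_(i < d) ('X + (k - i%:Z)%:~R%:P).

(* For f of degree d such an h exists and is unique. *)
Definition is_hstar (R : realType) (d : nat) (f : {poly R[i]})
    (h : 'I_d.+1 -> R[i]) : Prop :=
  f = \sum_(j < d.+1) h j *: binom_poly R (d%:Z - j%:Z) d.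

(* [size f = d.+1] says that f is non-zero of degree d. In the partial order
   of R[i], [0 <= z] means that z is real and non-negative. *)
Definition SNN (R : realType) (d : nat) (f : {poly R[i]}) : Prop :=
  size f = d.+1 /\
  exists h : 'I_d.+1 -> R[i], is_hstar f h /\ forall j, 0 <= h j.

(* Main.v *)
(** Dividing by the [j = 0] term, a zero [t] of [f] with [Re t > d - 1] gives a
    vanishing non-negative combination of the numbers
    [prod_(i < j) (t - i) / (t + d - i)].  These are all positive if [t] is real.
    Otherwise, for [d = 3, 4], those with [j > 0] lie strictly on the same side
    of the real axis as [t]: in the coordinates [s = Re t - (d - 1)] and
    [w = (Im t)^2], their imaginary part divided by [Im t] is, up to a positive
    factor, a polynomial with non-negative coefficients and positive constant
    term.  Hence all coefficients vanish.  The bound [Re t >= - d] follows from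
    the reflection [t -> - 1 - t], which reverses the h*-vector. *)

Require Import Defs.
From HB Require Import structures.
From mathcomp Require Import all_boot all_order all_algebra.
From mathcomp Require Import reals.
From mathcomp Require Import complex.
From mathcomp Require Import ring lra.

Set Implicit Arguments.
Unset Strict Implicit.
Unset Printing Implicit Defensive.

Import Order.TTheory GRing.Theory Num.Theory.

Local Open Scope ring_scope.
Local Open Scope complex_scope.

(** This is $d!\binom{t+d-j}{d}$. Dropping the factorial makes it meaningful in any commutative
    ring. *)
Definition hstar_prod (A : comPzRingType) (d : nat) (t : A) (j : nat) : A :=
  \prod_(i < d) (t + (d%:R - j%:R - i%:R)).

Lemma horner_hstar (R : realType) (d : nat) (h : 'I_d.+1 -> R[i]) (t : R[i]) :
  (\sum_(j < d.+1) h j *: binom_poly R (d%:Z - j%:Z) d).[t] =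
  (d`!%:R)^-1 * \sum_(j < d.+1) h j * hstar_prod d t j.
Proof.
rewrite horner_sum mulr_sumr; apply: eq_bigr => j _.
rewrite !hornerZ horner_prod mulrCA; congr (_ * (_ * _)).
apply: eq_bigr => i _.
by rewrite hornerD hornerX hornerC !rmorphB.
Qed.

(** Both sides are the product of the $d+1$ consecutive factors from $t+d-j$ down to $t-j$, with the
    first or the last one split off. *)
Lemma hstar_prodS (A : comPzRingType) (d j : nat) (t : A) :
  hstar_prod d t j.+1 * (t + d%:R - j%:R) = hstar_prod d t j * (t - j%:R).
Proof.
pose F (i : nat) : A := t + (d%:R - j%:R - i%:R).
transitivity (\prod_(i < d.+1) F i).
  rewrite big_ord_recl mulrC /F /=; congr (_ * _); first by ring.
  by apply: eq_bigr => i _; rewrite /= /bump /= add1n -!natr1; ring.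
by rewrite big_ord_recr /F /=; congr (_ * _); ring.
Qed.

Lemma hstar_prod_ratio (A : fieldType) (d j : nat) (t : A) :
  (forall i, (i < j)%N -> t + d%:R - i%:R != 0) ->
  hstar_prod d t j =
  hstar_prod d t 0 * \prod_(i < j) ((t - i%:R) / (t + d%:R - i%:R)).
Proof.
elim: j => [|j IHj] t_neq0; first by rewrite big_ord0 mulr1.
rewrite big_ord_recr mulrA -IHj => [|i i_lt_j]; last exact/t_neq0/ltnW.
by rewrite mulrA -hstar_prodS mulfK ?t_neq0.
Qed.

(** The reflection turns the factors for [j] into the negatives of those for [d - j], in reverse
    order. *)
Lemma hstar_prod_reflect (A : comPzRingType) (d j : nat) (t : A) :
  (j <= d)%N -> hstar_prod d (- 1 - t) j = (-1) ^+ d * hstar_prod d t (d - j).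
Proof.
move=> j_le_d; rewrite /hstar_prod (reindex_inj rev_ord_inj) /=.
rewrite -[in (-1) ^+ d](card_ord d) -prodrN; apply: eq_bigr => i _.
by rewrite !natrB // -natr1; ring.
Qed.

(** With $t = x + iy$, this is $t - i$ times the conjugate of $t + d - i$ (here the subtracted $i$
    is the index), so it is the ratio up to a positive real factor. *)
Definition ratio_num (R : rcfType) (d : nat) (x y : R) (i : nat) : R[i] :=
  ((x - i%:R) * (x + d%:R - i%:R) + y ^+ 2) +i* (d%:R * y).

Lemma ratio_numE (R : rcfType) (d i : nat) (x y : R) :
  let t := x +i* y in
  (t - i%:R) / (t + d%:R - i%:R) =
  `|t + d%:R - i%:R| ^- 2 * ratio_num d x y i.
Proof.
move=> t; rewrite invc_norm mulrCA; congr (_ * _).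
have natE n : n%:R = n%:R +i* 0 :> R[i] by rewrite complexr0 rmorph_nat.
rewrite /t !natE /ratio_num; simpc.
by apply/eqP; rewrite eq_complex /=; apply/andP; split; apply/eqP; ring.
Qed.

Lemma Im_prod_ratio_num_gt0 (R : rcfType) (d j : nat) (x y : R) :
    d = 3%N \/ d = 4%N -> (0 < j <= d)%N -> d%:R - 1 < x -> y != 0 ->
  0 < y * complex.Im (\prod_(i < j) ratio_num d x y i).
Proof.
move=> d34 j_bnd x_gt y_neq0.
have [s s_ge0 ->] : exists2 s : R, 0 <= s & x = s + (d%:R - 1).
  by exists (x - (d%:R - 1)); rewrite ?subrK // subr_ge0 ltW.
have y2_gt0 : 0 < y ^+ 2 by rewrite exprn_even_gt0.
have pos Q e : e = y ^+ 2 * Q -> 0 < Q -> 0 < e.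
  by move=> -> Q_gt0; rewrite mulr_gt0.
(* Seven cases remain: [j] = 1, 2, 3 for [d = 3], then [j] = 1, 2, 3, 4 for [d = 4]. Each witness is
   the imaginary part of the product divided by [y], expanded in [s] and [y ^+ 2]. *)
case: d34 j_bnd x_gt => -> j_bnd _; move: j j_bnd => [|[|[|[|[|j]]]]] // _;
  rewrite !big_ord_recr big_ord0 /= mul1r /ratio_num /=;
  [ apply: (pos 3)
  | apply: (pos (42 + 36 * s + 6 * s ^+ 2 + 6 * y ^+ 2))
  | apply: (pos (120 + 360 * s + 297 * s ^+ 2 + 90 * s ^+ 3 + 9 * s ^+ 4
      + 57 * y ^+ 2 + 90 * s * y ^+ 2 + 18 * s ^+ 2 * y ^+ 2 + 9 * y ^+ 4))
  | apply: (pos 4)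
  | apply: (pos (132 + 72 * s + 8 * s ^+ 2 + 8 * y ^+ 2))
  | apply: (pos (1668 + 2304 * s + 1056 * s ^+ 2 + 192 * s ^+ 3 + 12 * s ^+ 4
      + 240 * y ^+ 2 + 192 * s * y ^+ 2 + 24 * s ^+ 2 * y ^+ 2 + 12 * y ^+ 4))
  | apply: (pos (5040 + 18480 * s + 21064 * s ^+ 2 + 10752 * s ^+ 3
      + 2728 * s ^+ 4 + 336 * s ^+ 5 + 16 * s ^+ 6
      + 904 * y ^+ 2 + 4032 * s * y ^+ 2 + 2928 * s ^+ 2 * y ^+ 2
      + 672 * s ^+ 3 * y ^+ 2 + 48 * s ^+ 4 * y ^+ 2
      + 200 * y ^+ 4 + 336 * s * y ^+ 4 + 48 * s ^+ 2 * y ^+ 4 + 16 * y ^+ 6)) ];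
  solve [ ring
        | by do ![ exact: ltr0n | exact: exprn_ge0 | exact: exprn_even_ge0
                 | apply: mulr_ge0 | apply: ltr_wpDr ] ].
Qed.

Lemma prod_ratio_num_gt0 (R : rcfType) (d j : nat) (x : R) :
  (j <= d)%N -> d%:R - 1 < x -> 0 < \prod_(i < j) ratio_num d x 0 i.
Proof.
move=> j_le_d x_gt; apply: prodr_gt0 => i _.
rewrite /ratio_num ltcE /= mulr0 expr0n addr0 eqxx /=.
have i_le : i%:R <= d%:R - 1 :> R.
  by rewrite lerBrDr natr1 ler_nat (leq_trans (ltn_ord i)).
by rewrite mulr_gt0 //; [|have := ler0n R d]; lra.
Qed.

(** The imaginary part of the sum, times [y], is a sum of non-negative terms, so each term vanishes.
    This kills [g j] for [j != ord0], and then [W ord0 = 1] leaves only [g ord0 = 0]. *)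
Lemma cone_eq0 (R : rcfType) (d : nat) (g W : 'I_d.+1 -> R[i]) (y : R) :
    (forall j, 0 <= g j) -> W ord0 = 1 ->
    (forall j, j != ord0 -> 0 < y * complex.Im (W j)) ->
    \sum_j g j * W j = 0 -> forall j, g j = 0.
Proof.
move=> g_ge0 W0 W_gt0 sum_eq0.
have g_im j : complex.Im (g j) = 0 by exact: ger0_Im.
have Re_ge0 j : 0 <= complex.Re (g j).
  by have := g_ge0 j; rewrite lecE => /andP[].
have ImE j : complex.Im (g j * W j) = complex.Re (g j) * complex.Im (W j).
  by move: (g_im j); case: (g j) (W j) => [a b] [u v] /= ->; ring.
have term_ge0 j : 0 <= y * complex.Im (g j * W j).
  rewrite ImE mulrCA; have [->|/W_gt0/ltW yW_ge0] := eqVneq j ord0.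
    by rewrite W0 /= !mulr0.
  exact: mulr_ge0.
have /psumr_eq0P term_eq0 : \sum_j y * complex.Im (g j * W j) = 0.
  by rewrite -mulr_sumr -(raddf_sum (@complex.Im R)) sum_eq0 mulr0.
have g_eq0 j : j != ord0 -> g j = 0.
  move=> j_neq0; have /eqP := term_eq0 (fun i _ => term_ge0 i) j isT.
  rewrite ImE mulrCA mulf_eq0 (gt_eqF (W_gt0 j j_neq0)) orbF => /eqP Re_eq0.
  by apply/eqP; rewrite eq_complex Re_eq0 g_im /= eqxx.
move=> j; have [->|/g_eq0 //] := eqVneq j ord0.
move: sum_eq0; rewrite (bigD1 ord0) //= W0 mulr1 big1 ?addr0 // => i /g_eq0 ->.
by rewrite mul0r.
Qed.

Lemma hstar_sum_eq0 (R : rcfType) (d : nat) (h : 'I_d.+1 -> R[i]) (t : R[i]) :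
    d = 3%N \/ d = 4%N -> (forall j, 0 <= h j) -> d%:R - 1 < complex.Re t ->
    \sum_(j < d.+1) h j * hstar_prod d t j = 0 -> forall j, h j = 0.
Proof.
case: t => x y d34 h_ge0 /= x_gt sum_eq0; pose t := x +i* y.
have natE n : n%:R = n%:R +i* 0 :> R[i] by rewrite complexr0 rmorph_nat.
have t_neq0 (i : nat) : (i < d)%N -> t + d%:R - i%:R != 0.
  move=> i_lt_d; rewrite /t !natE; simpc.
  rewrite eq_complex negb_and /= gt_eqF //.
  have: i%:R <= d%:R :> R by rewrite ler_nat ltnW.
  have: 1 <= d%:R :> R by rewrite ler1n; case: d34 => ->.
  by lra.
have prod0_neq0 : hstar_prod d t 0 != 0.
  apply/prodf_neq0 => i _; have := t_neq0 i (ltn_ord i).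
  by rewrite subr0 addrA.
(* The positive factors lost in passing from ratios to [ratio_num] are absorbed into the weights
   [h j * c j]. *)
pose c j : R[i] := \prod_(i < j) `|t + d%:R - i%:R| ^- 2.
have c_gt0 (j : 'I_d.+1) : 0 < c j.
  apply: prodr_gt0 => i _; rewrite invr_gt0 exprn_gt0 // normr_gt0 t_neq0 //.
  exact: leq_trans (ltn_ord i) (leq_ord j).
pose W (j : 'I_d.+1) := \prod_(i < j) ratio_num d x y i.
have prodE (j : 'I_d.+1) : hstar_prod d t j = hstar_prod d t 0 * (c j * W j).
  rewrite hstar_prod_ratio => [|i i_lt_j]; last first.
    by rewrite t_neq0 // (leq_trans i_lt_j (leq_ord j)).
  rewrite -big_split /=; congr (_ * _); apply: eq_bigr => i _.
  exact: ratio_numE.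
have gW_eq0 : \sum_j (h j * c j) * W j = 0.
  apply/(mulfI prod0_neq0); rewrite mulr0 -[RHS]sum_eq0 mulr_sumr.
  by apply: eq_bigr => j _; rewrite prodE; ring.
have g_ge0 j : 0 <= h j * c j by rewrite mulr_ge0 // ltW.
suff g_eq0 j : h j * c j = 0.
  move=> j; apply/eqP; have /eqP := g_eq0 j.
  by rewrite mulf_eq0 (gt_eqF (c_gt0 j)) orbF.
(* For real [t] the imaginary parts carry no information, but every [W j] is then a positive
   real. *)
have [y_eq0|y_neq0] := eqVneq y 0.
  have W_gt0 i : 0 < W i.
    by rewrite /W y_eq0 prod_ratio_num_gt0 // leq_ord.
  have /psumr_eq0P/(_ j isT)/eqP := gW_eq0.
  rewrite mulf_eq0 (gt_eqF (W_gt0 j)) orbF => H.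
  by apply/eqP/H => i _; rewrite mulr_ge0 // ltW.
apply: (@cone_eq0 _ _ (fun j => h j * c j) W y) => // [|i i_neq0].
  by rewrite /W big_ord0.
by rewrite Im_prod_ratio_num_gt0 // leq_ord andbT lt0n.
Qed.

Theorem theorem3p3 (R : realType) (d : nat) (hd : d = 3%N \/ d = 4%N)
    (f : {poly R[i]}) (hf : SNN d f) (alpha : R[i]) (halpha : root f alpha) :
  - d%:R <= complex.Re alpha <= d%:R - 1.
Proof.
case: hf => size_f [h [f_eq h_ge0]].
have h_neq0 : ~ forall j, h j = 0.
  move=> h_eq0; move: size_f; rewrite f_eq big1 ?size_poly0 // => j _.
  by rewrite h_eq0 scale0r.
have sum_eq0 : \sum_(j < d.+1) h j * hstar_prod d alpha j = 0.
  move: halpha; rewrite rootE f_eq horner_hstar mulf_eq0 invr_eq0.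
  by rewrite pnatr_eq0 eqn0Ngt fact_gt0 /= => /eqP.
rewrite !leNgt; apply/andP; split; apply/negP => alpha_out; apply: h_neq0.
  (* A root to the left of $-d$ is reflected to the right of $d-1$, where the reversed vector
     [h (rev_ord j)] gives a vanishing sum. *)
  have Re_refl : d%:R - 1 < complex.Re (- 1 - alpha).
    by rewrite raddfB raddfN /=; lra.
  suff h_rev : forall j, h (rev_ord j) = 0.
    by move=> j; rewrite -(rev_ordK j).
  apply: (hstar_sum_eq0 (t := - 1 - alpha) hd _ Re_refl) => //.
  transitivity ((-1) ^+ d * \sum_(j < d.+1) h j * hstar_prod d alpha j).
    rewrite mulr_sumr [LHS](reindex_inj rev_ord_inj); apply: eq_bigr => j _.
    rewrite rev_ordK /= subSS hstar_prod_reflect ?leq_subr //.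
    by rewrite subKn ?leq_ord // mulrCA.
  by rewrite sum_eq0 mulr0.
exact: hstar_sum_eq0 hd h_ge0 alpha_out sum_eq0.
Qed.
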